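(* Let $x_0\in\mathbb R$. The following curves generate $3$-invariant minimal surfaces in $\mathrm{Sol}_3$: 1. (type III) $\alpha(s)=\frac{s}{\sqrt2}(1,1,0)+(x_0,x_0,0)$, $s\in\mathbb R$, which is the solution curve with $x(0)=y(0)=x_0$ and $\theta(s)=\pi/4$ for all $s$; 2. (type IV) $\alpha(s)=\frac{s}{\sqrt2}(1,-1,0)+(x_0,-x_0,0)$, $s\in\mathbb R$, which is the solution curve with $x(0)=x_0$, $y(0)=-x_0$ and $\theta(s)=-\pi/4$ for all $s$. Here ''solution curve'' means that $\alpha(s)=(x(s),y(s),0)$ where $(x,y,\theta)$ solves $$x'=\cos\theta,\qquad y'=\sin\theta,\qquad \theta'=\sin(2\theta)\,\frac{-x\cos\theta+y\sin\theta}{1+x^2+y^2}.$$ Moreover both surfaces are ruled: if $\psi(s,t)$ is the parametrization of the generated surface, then for every $t\in\mathbb R$ the curve $s\mapsto\psi(s,t)$ is a geodesic of $\mathrm{Sol}_3$.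
   Context: $\mathrm{Sol}_3$ is $\mathbb R^3$ with coordinates $(x,y,z)$ and the Riemannian metric $\langle\,,\rangle=e^{2z}dx^2+e^{-2z}dy^2+dz^2$. For $t\in\mathbb R$ the map $L_t(x,y,z)=(e^{-t}x,e^ty,z+t)$ is an isometry; a surface is called $3$-invariant if it is invariant under all $L_t$, $t\in\mathbb R$. The $3$-invariant surface generated by a regular curve $\alpha(s)=(x(s),y(s),0)$, $s\in I$, in the plane $z=0$ is the immersed surface $\psi(s,t)=L_t(\alpha(s))=(e^{-t}x(s),e^{t}y(s),t)$, $s\in I$, $t\in\mathbb R$. Minimal means zero mean curvature. *)

(* Defs.v *)
From HB Require Import structures.
From mathcomp Require Import all_boot all_order all_algebra.
From mathcomp Require Import all_classical all_reals all_analysis.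
Import Order.TTheory GRing.Theory Num.Theory.
Import numFieldNormedType.Exports.

Set Implicit Arguments.
Unset Strict Implicit.
Unset Printing Implicit Defensive.

Local Open Scope classical_set_scope.
Local Open Scope ring_scope.

Section Calculus.
Context {R : realType} {V W : normedModType R}.

(* [Ck n f]: all directional derivatives of [f] of order at most [n] exist at
   every point and are continuous. *)
Fixpoint Ck (n : nat) (f : V -> W) : Prop :=
  continuous f /\
  if n is m.+1 then forall v : V, (forall p, derivable f p v) /\ Ck m ('D_v f)
  else True.

Definition smooth (f : V -> W) : Prop := forall n, Ck n f.

(* Differentiability follows from smoothness in finite dimension; it is listed
   because ['d f p] is only meaningful for a differentiable [f]. *)
Definition immersion (f : V -> W) : Prop :=
  smooth f /\ forall p, differentiable f p /\ injective ('d f p : V -> W).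

End Calculus.

(** Riemannian geometry of [R^3] in one global chart: points and coordinate
    vectors are row vectors, and a metric maps each point to its Gram matrix. *)
Section Riemann.
Context {R : realType}.
Implicit Types (g : 'rV[R]_3 -> 'M[R]_3) (p u v w : 'rV[R]_3).

Definition row3 (a b c : R) : 'rV[R]_3 := \row_(i < 3) [:: a; b; c]`_i.

Definition inner g p u v : R := (u *m g p *m v^T) 0 0.

Definition partial (i : 'I_3) (f : 'rV[R]_3 -> R) p : R :=
  'D_(delta_mx 0 i : 'rV[R]_3) f p.

(* Christoffel symbols [Gamma^k_ij] of the Levi-Civita connection. *)
Definition christoffel g p (k i j : 'I_3) : R :=
  2^-1 * \sum_(l < 3) invmx (g p) k l *
    (partial i (fun q => g q j l) p + partial j (fun q => g q i l) p
     - partial l (fun q => g q i j) p).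

(* Covariant derivative at [a], in the direction [e] of the parameter space, of
   a vector field [X] along the map [f]. *)
Definition covD (V : normedModType R) g (f : V -> 'rV[R]_3) (e : V)
    (X : V -> 'rV[R]_3) (a : V) : 'rV[R]_3 :=
  'D_e X a + \row_(k < 3) \sum_(i < 3) \sum_(j < 3)
    christoffel g (f a) k i j * ('D_e f a) 0 i * X a 0 j.

Definition geodesic g (c : R -> 'rV[R]_3) : Prop :=
  smooth c /\ forall s, covD g c 1 ('D_1 c) s = 0.

(* The row vector of the linear form [w |-> det (u, v, w)]. *)
Definition cross u v : 'rV[R]_3 :=
  row3 (u 0 1 * v 0 2 - u 0 2 * v 0 1)
       (u 0 2 * v 0 0 - u 0 0 * v 0 2)
       (u 0 0 * v 0 1 - u 0 1 * v 0 0).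

(* [cross u v] annihilates [u] and [v]; raising its index with the inverse
   metric gives a vector [g]-orthogonal to both, which is then normalized. *)
Definition unit_normal g p u v : 'rV[R]_3 :=
  let n := cross u v *m invmx (g p) in (Num.sqrt (inner g p n n))^-1 *: n.

Section Surfaces.
Variables (g : 'rV[R]_3 -> 'M[R]_3) (psi : R * R -> 'rV[R]_3).

Definition dir_s : R * R := (1, 0).
Definition dir_t : R * R := (0, 1).

Definition mean_curvature (a : R * R) : R :=
  let u := 'D_dir_s psi a in
  let v := 'D_dir_t psi a in
  let N := unit_normal g (psi a) u v in
  let E := inner g (psi a) u u in
  let F := inner g (psi a) u v in
  let G := inner g (psi a) v v in
  let l := inner g (psi a) (covD g psi dir_s ('D_dir_s psi) a) N in
  let m := inner g (psi a) (covD g psi dir_s ('D_dir_t psi) a) N in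
  let n := inner g (psi a) (covD g psi dir_t ('D_dir_t psi) a) N in
  (E * n - 2 * F * m + G * l) / (2 * (E * G - F ^+ 2)).

Definition minimal_surface : Prop :=
  immersion psi /\ forall a, mean_curvature a = 0.

End Surfaces.

Definition sol_metric p : 'M[R]_3 :=
  diag_mx (row3 (expR (2 * p 0 2)) (expR (- (2 * p 0 2))) 1).

Definition sol_L (t : R) p : 'rV[R]_3 :=
  row3 (expR (- t) * p 0 0) (expR t * p 0 1) (p 0 2 + t).

Definition three_invariant (S : set 'rV[R]_3) : Prop :=
  forall t, sol_L t @` S = S.

Definition generated_surface (alpha : R -> 'rV[R]_3) (a : R * R) : 'rV[R]_3 :=
  sol_L a.2 (alpha a.1).

(* A minimal immersion on all of [R * R], with 3-invariant image, generated by
   the regular curve [alpha]. *)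
Definition generates_minimal (alpha : R -> 'rV[R]_3) : Prop :=
  [/\ immersion alpha,
      minimal_surface sol_metric (generated_surface alpha)
    & three_invariant (range (generated_surface alpha))].

Definition solution_curve (alpha : R -> 'rV[R]_3) (theta : R -> R) : Prop :=
  exists x y : R -> R,
    (forall s, alpha s = row3 (x s) (y s) 0) /\
    forall s,
      [/\ is_derive s (1 : R) x (cos (theta s)),
          is_derive s (1 : R) y (sin (theta s))
        & is_derive s (1 : R) theta (sin (2 * theta s) *
            ((- x s * cos (theta s) + y s * sin (theta s))
             / (1 + x s ^+ 2 + y s ^+ 2)))].

(* [alpha] is the only solution curve with angle function [theta] that starts
   at [p]. *)
Definition is_the_solution_curve (alpha : R -> 'rV[R]_3) (theta : R -> R) p :
    Prop :=
  [/\ solution_curve alpha theta, alpha 0 = p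
    & forall beta, solution_curve beta theta -> beta 0 = p -> beta = alpha].

Definition ruled (psi : R * R -> 'rV[R]_3) : Prop :=
  forall t, geodesic sol_metric (fun s => psi (s, t)).

End Riemann.

(* Main.v *)
Require Import Defs.
From mathcomp Require Import all_boot all_order all_algebra.
From mathcomp Require Import all_classical all_reals all_analysis.
From mathcomp Require Import ring lra.
Import Order.TTheory GRing.Theory Num.Theory.
Import numFieldNormedType.Exports.
Local Open Scope ring_scope.

(** With [eps = 1] (type III) or [eps = -1] (type IV), the generated surface is
    [psi (s, t) = (e^-t c, eps e^t c, t)], where [c = s / sqrt 2 + x0].  For
    fixed [t] it is affine in [s], and the only Christoffel term that could
    spoil the geodesic equation, the [z]-component
    [e^-2z y'^2 - e^2z x'^2], vanishes along it.  Hence the second fundamental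
    form is zero on [psi_s].  Moreover [psi_s] and [psi_t] are orthogonal, and
    the covariant derivative of [psi_t] along [t] is a multiple of [psi_s], so
    the second fundamental form is also zero on [psi_t] and the mean curvature
    vanishes. *)

(** Induction on the order: differentiability gives continuity and all directional derivatives, and
    closure applies the induction hypothesis to ['D_v f]. No iterated derivative has to be
    computed. *)
Lemma smooth_of_closed_family (R : realType) (V W : normedModType R)
    (P : (V -> W) -> Prop) :
  (forall f p, P f -> differentiable f p) ->
  (forall f v, P f -> P ('D_v f)) -> forall f, P f -> smooth f.
Proof.
move=> Pdiff PD f Pf n; elim: n f Pf => [|n IHn] f Pf /=.
  by split=> // p; apply/differentiable_continuous/Pdiff.
split=> [p|v]; first exact/differentiable_continuous/Pdiff.
by split=> [p|]; [apply/diff_derivable/Pdiff|apply/IHn/PD].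
Qed.

(** * Coordinates and differentials of row vectors *)

Section Row3.
Context {R : realType}.

Lemma row3_eqP (u v : 'rV[R]_3) :
  u 0 0 = v 0 0 -> u 0 1 = v 0 1 -> u 0 2 = v 0 2 -> u = v.
Proof.
move=> e0 e1 e2; apply/rowP; case=> -[|[|[|//]]] i3.
- by rewrite (_ : Ordinal i3 = 0) //; exact: val_inj.
- by rewrite (_ : Ordinal i3 = 1) //; exact: val_inj.
- by rewrite (_ : Ordinal i3 = 2) //; exact: val_inj.
Qed.

Lemma row3E0 (a b c : R) : row3 a b c 0 0 = a. Proof. by rewrite mxE. Qed.
Lemma row3E1 (a b c : R) : row3 a b c 0 1 = b. Proof. by rewrite mxE. Qed.
Lemma row3E2 (a b c : R) : row3 a b c 0 2 = c. Proof. by rewrite mxE. Qed.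
Definition row3E := (row3E0, row3E1, row3E2).

Lemma row3D (a b c a' b' c' : R) :
  row3 a b c + row3 a' b' c' = row3 (a + a') (b + b') (c + c').
Proof. by apply: row3_eqP; rewrite mxE !row3E. Qed.

Lemma row3Z (k a b c : R) : k *: row3 a b c = row3 (k * a) (k * b) (k * c).
Proof. by apply: row3_eqP; rewrite mxE !row3E. Qed.

Lemma sum3E (V : zmodType) (F : 'I_3 -> V) : \sum_(i < 3) F i = F 0 + F 1 + F 2.
Proof.
rewrite 3!big_ord_recl big_ord0 addr0 addrA.
by congr (F _ + F _ + F _); apply: val_inj.
Qed.

Lemma is_diff_scalel_comp (V W : normedModType R) (f df : V -> R) (w : W) p :
  is_diff p f df -> is_diff p (fun q => f q *: w) (fun v => df v *: w).
Proof.
move=> Df.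
exact: (@is_diff_comp _ _ _ _ f df _ _ p Df (is_diff_scalel (f p) w)).
Qed.

Lemma is_diff_row3 (V : normedModType R) (f g h df dg dh : V -> R) (p : V) :
  is_diff p f df -> is_diff p g dg -> is_diff p h dh ->
  is_diff p (fun q => row3 (f q) (g q) (h q))
            (fun v => row3 (df v) (dg v) (dh v)).
Proof.
move=> Df Dg Dh.
(* Expanding along the standard basis leaves sums of scalar functions times constant vectors. *)
have row3_split (f1 f2 f3 : V -> R) : (fun q => row3 (f1 q) (f2 q) (f3 q)) =
    (fun q => f1 q *: row3 1 0 0) + (fun q => f2 q *: row3 0 1 0)
    + (fun q => f3 q *: row3 0 0 1).
  apply/funext => q; rewrite !fctE /= !row3Z.
  by rewrite !row3D !(mulr0, mulr1, addr0, add0r).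
rewrite (row3_split f g h) (row3_split df dg dh).
have D1 := is_diff_scalel_comp _ _ _ _ (row3 1 0 0) _ Df.
have D2 := is_diff_scalel_comp _ _ _ _ (row3 0 1 0) _ Dg.
have D3 := is_diff_scalel_comp _ _ _ _ (row3 0 0 1) _ Dh.
exact: (@is_diffD _ _ _ _ _ _ _ _ (@is_diffD _ _ _ _ _ _ _ _ D1 D2) D3).
Qed.

End Row3.

(** * Connection and unit normal of [Sol_3]; a criterion for zero mean curvature *)

Section SolGeometry.
Context {R : realType}.
Implicit Types (p q u v : 'rV[R]_3).

Lemma derive_coord2 (phi : R -> R) p v (dphi : R) :
  is_derive (p 0 2) (1 : R) phi dphi ->
  'D_v (fun q : 'rV[R]_3 => phi (q 0 2)) p = v 0 2 * dphi.
Proof.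
move=> phiD.
(* As [q 0 2] is linear in [q], both sides have the same difference quotients. *)
have -> : 'D_v (fun q : 'rV[R]_3 => phi (q 0 2)) p = 'D_(v 0 2) phi (p 0 2).
  rewrite /derive; set F1 := (fun h => _); set F2 := (fun h => _ : R).
  by rewrite (_ : F1 = F2) //; apply/funext => h; rewrite /F1 /F2 /= !mxE.
have dphi1 : differentiable phi (p 0 2) by case: phiD => /derivable1_diffP.
rewrite deriveE // -[X in 'd _ _ X]mulr1 -[_ * 1]/(v 0 2 *: (1 : R)) linearZ /=.
by rewrite -deriveE // derive_val.
Qed.

Lemma inv_sol_metric p :
  invmx (sol_metric p) =
  diag_mx (row3 (expR (- (2 * p 0 2))) (expR (2 * p 0 2)) 1).
Proof.
set D := diag_mx _.
have DM : D *m sol_metric p = 1%:M.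
  rewrite mulmx_diag -diag_const_mx; congr diag_mx.
  by apply: row3_eqP; rewrite !mxE /= ?mulr1 // -expRD ?addNr ?subrr expR0.
by have [_ uM] := mulmx1_unit DM; rewrite -[RHS](mulmxK uM) DM mul1mx.
Qed.

(** The metric is diagonal and depends on [z] only, and its last entry is constant. *)
Lemma partial_sol_metric (i j l : 'I_3) p :
  partial i (fun q => sol_metric q j l) p =
  ((i == 2) && (j == l))%:R *
    row3 (2 * expR (2 * p 0 2)) (- (2 * expR (- (2 * p 0 2)))) 0 0 j.
Proof.
rewrite /partial.
under eq_fun do rewrite !mxE.
have [_|_] := eqVneq j l; last first.
  by rewrite andbF mul0r; under eq_fun do rewrite mulr0n; exact: derive_cst.
under eq_fun do rewrite mulr1n.
have dE (phi : R -> R) (dphi : R) : is_derive (p 0 2) (1 : R) phi dphi ->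
    'D_(delta_mx 0 i) (fun q : 'rV[R]_3 => phi (q 0 2)) p = (i == 2)%:R * dphi.
  by move=> /derive_coord2 ->; rewrite mxE eqxx /= eq_sym.
rewrite andbT; case: j => -[|[|[|//]]] j3 /=; rewrite ?mxE /=.
- apply: (dE (fun z => expR (2 * z))).
  by apply: is_derive_eq; rewrite /GRing.scale /=; ring.
- apply: (dE (fun z => expR (- (2 * z)))).
  by apply: is_derive_eq; rewrite /GRing.scale /=; ring.
- by rewrite mulr0; exact: derive_cst.
Qed.

Lemma christoffel_sol p (k i j : 'I_3) :
  let d := row3 (2 * expR (2 * p 0 2)) (- (2 * expR (- (2 * p 0 2)))) 0 in
  christoffel sol_metric p k i j =
  2^-1 * (row3 (expR (- (2 * p 0 2))) (expR (2 * p 0 2)) 1 0 k *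
    (((i == 2) && (j == k))%:R * d 0 j + ((j == 2) && (i == k))%:R * d 0 i
     - ((k == 2) && (i == j))%:R * d 0 i)).
Proof.
rewrite /christoffel inv_sol_metric (bigD1 k) //= big1 ?addr0.
  by rewrite !partial_sol_metric [diag_mx _ _ _]mxE eqxx mulr1n.
by move=> l lk; rewrite mxE eq_sym (negbTE lk) mulr0n mul0r.
Qed.

(** Up to symmetry in the lower indices, the nonzero Christoffel symbols are [G^x_xz = 1],
    [G^y_yz = -1], [G^z_xx = - e^2z] and [G^z_yy = e^-2z]. *)
Lemma covD_sol (V : normedModType R) (f X : V -> 'rV[R]_3) (e a : V) :
  let u := 'D_e f a in let x := X a in let z := f a 0 2 in
  covD sol_metric f e X a = 'D_e X a +
    row3 (u 0 0 * x 0 2 + u 0 2 * x 0 0)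
         (- (u 0 1 * x 0 2 + u 0 2 * x 0 1))
         (expR (- (2 * z)) * (u 0 1 * x 0 1)
          - expR (2 * z) * (u 0 0 * x 0 0)).
Proof.
move=> u x z; congr (_ + _); rewrite -/u -/x.
have eK : expR (- (2 * z)) * expR (2 * z) = 1 by rewrite -expRD addNr expR0.
apply: row3_eqP; rewrite [LHS]mxE !sum3E !christoffel_sol !row3E /= -/z.
all: move: eK; generalize (expR (- (2 * z)) : R) (expR (2 * z) : R).
all: generalize (u 0 0 : R) (u 0 1 : R) (u 0 2 : R).
all: generalize (x 0 0 : R) (x 0 1 : R) (x 0 2 : R).
all: move=> x0 x1 x2 u0 u1 u2 b c eK.
all: rewrite !(mul0r, mulr0, addr0, add0r, subr0, mul1r, sub0r).
all: by field: eK.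
Qed.

Lemma inner_sol p u v :
  inner sol_metric p u v = expR (2 * p 0 2) * (u 0 0 * v 0 0)
    + expR (- (2 * p 0 2)) * (u 0 1 * v 0 1) + u 0 2 * v 0 2.
Proof.
rewrite /inner /sol_metric mul_mx_diag mxE sum3E !mxE /=; ring.
Qed.

(** The metric cancels the inverse metric that raises the index, which leaves a multiple of
    [det (u, v, u) = 0]. *)
Lemma unit_normal_sol_orthogonal p u v :
  inner sol_metric p u (unit_normal sol_metric p u v) = 0.
Proof.
have eK := expRxMexpNx_1 (2 * p 0 2).
rewrite /unit_normal; set k := (Num.sqrt _)^-1; rewrite !inner_sol.
rewrite inv_sol_metric mul_mx_diag !mxE /=.
move: eK; generalize (expR (2 * p 0 2) : R) (expR (- (2 * p 0 2)) : R).
generalize (u 0 0 : R) (u 0 1 : R) (u 0 2 : R).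
generalize (v 0 0 : R) (v 0 1 : R) (v 0 2 : R).
by move=> v0 v1 v2 u0 u1 u2 b c eK; ring: eK.
Qed.

(** Each term of the numerator has a zero factor: [F = 0] removes the mixed term without computing
    [m], [l] is zero, and [n] is [c] times the product of [u] with the normal. *)
Lemma mean_curvature_sol_eq0 (psi : R * R -> 'rV[R]_3) (a : R * R) (c : R) :
  let u := 'D_dir_s psi a in let v := 'D_dir_t psi a in
  inner sol_metric (psi a) u v = 0 ->
  covD sol_metric psi dir_s ('D_dir_s psi) a = 0 ->
  covD sol_metric psi dir_t ('D_dir_t psi) a = c *: u ->
  mean_curvature sol_metric psi a = 0.
Proof.
move=> u v F0 l0 nc.
have uN := unit_normal_sol_orthogonal (psi a) u v.
have zero (E F G l m n : R) : F = 0 -> l = 0 -> n = 0 ->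
    (E * n - 2 * F * m + G * l) / (2 * (E * G - F ^+ 2)) = 0.
  by move=> -> -> ->; rewrite !(mulr0, mul0r, addr0, subr0).
apply: zero => //; first by rewrite l0 /inner !mul0mx mxE.
by rewrite nc /inner -!scalemxAl mxE -/(inner _ _ _ _) uN mulr0.
Qed.

End SolGeometry.

(** * Affine curves *)

Section AffineCurve.
Context {R : realType} {W : normedModType R}.
Implicit Types (u w : W).

Lemma is_diff_affine u w (s : R) :
  is_diff s (fun t : R => t *: u + w) (fun v : R => v *: u).
Proof.
have : is_diff s (( *:%R^~ u) + cst w) (( *:%R^~ u) + 0).
  exact: is_diffD.
by rewrite addr0.
Qed.

Lemma derive_affineE u w (v s : R) : 'D_v (fun t : R => t *: u + w) s = v *: u.
Proof. by have H := is_diff_affine u w s; rewrite deriveE ?diff_val. Qed.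

Lemma derive_affine u w v : 'D_v (fun t : R => t *: u + w) = fun=> v *: u.
Proof. by apply/funext => s; exact: derive_affineE. Qed.

Lemma smooth_affine u w : smooth (fun t : R => t *: u + w).
Proof.
pose P (f : R -> W) := exists u w, f = fun t => t *: u + w.
apply: (@smooth_of_closed_family R R^o W P).
- by move=> f p [u' [w' ->]]; case: (is_diff_affine u' w' p).
(* The derivative is constant, hence affine with direction 0. *)
- move=> f v [u' [w' ->]]; exists 0, (v *: u'); rewrite derive_affine.
  by apply/funext => t; rewrite scaler0 add0r.
- by exists u, w.
Qed.

Lemma immersion_affine u w : u != 0 -> immersion (fun t : R => t *: u + w).
Proof.
move=> u0; split=> [|s]; first exact: smooth_affine.
have D := is_diff_affine u w s; split; first by case: D.
rewrite diff_val => a b /eqP; rewrite -subr_eq0 -scalerBl scaler_eq0 (negbTE u0).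
by rewrite orbF subr_eq0 => /eqP.
Qed.

End AffineCurve.

(** * Surfaces with affine-times-exponential coordinates *)

Section Surface.
Context {R : realType}.

Lemma expR_double (t : R) : expR (2 * t) = expR t * expR t.
Proof. by rewrite -expRD; congr expR; ring. Qed.

Lemma expRN_double (t : R) : expR (- (2 * t)) = expR (- t) * expR (- t).
Proof. by rewrite -expRD; congr expR; ring. Qed.

(* This family contains the generated surfaces and, unlike them, is closed under
   directional derivatives, which makes its members smooth by induction. *)
Definition exp_surface (a b c d q r : R) (p : R * R) : 'rV[R]_3 :=
  row3 ((a * p.1 + b) * expR (- p.2)) ((c * p.1 + d) * expR p.2) (q * p.2 + r).

Lemma is_diff_fst (p : R * R) : is_diff p (fst : R * R -> R) fst.
Proof.
have fst_cont : continuous (fst : R * R -> R) by move=> x; exact: cvg_fst.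
by apply: DiffDef; [exact: linear_differentiable|rewrite diff_lin].
Qed.

Lemma is_diff_snd (p : R * R) : is_diff p (snd : R * R -> R) snd.
Proof.
have snd_cont : continuous (snd : R * R -> R) by move=> x; exact: cvg_snd.
by apply: DiffDef; [exact: linear_differentiable|rewrite diff_lin].
Qed.

Lemma is_diff_expR (x : R) : is_diff x (@expR R) (fun h => h * expR x).
Proof.
have dx : differentiable (@expR R) x by apply/derivable1_diffP.
by apply: DiffDef => //; rewrite diff1E // derive1E derive_val.
Qed.

(** Used with [c = -1] and [c = 1] for the first two coordinates of [exp_surface]. *)
Lemma is_diff_affine_expR (a b c : R) (p : R * R) :
  is_diff p (fun p => (a * p.1 + b) * expR (c * p.2))
    (fun v => (a * v.1 + c * v.2 * (a * p.1 + b)) * expR (c * p.2)).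
Proof.
have D1 := is_diff_fst p; have D2 := is_diff_snd p.
have De : is_diff p (@expR R \o (c *: snd))
    ((fun h => h * expR (c * p.2)) \o (c *: snd)).
  by apply: is_diff_comp; exact: is_diff_expR.
have Da : is_diff p ((a *: fst) + cst b) (a *: fst).
  by rewrite -[X in is_diff _ _ X]addr0; exact: is_diffD.
have H := is_diffM Da De.
apply: is_diff_eq; apply/funext => v; rewrite !fctE /= /GRing.scale /=.
by ring.
Qed.

Lemma is_diff_exp_surface (a b c d q r : R) (p : R * R) :
  is_diff p (exp_surface a b c d q r)
    (fun v => row3 ((a * v.1 - v.2 * (a * p.1 + b)) * expR (- p.2))
                   ((c * v.1 + v.2 * (c * p.1 + d)) * expR p.2) (q * v.2)).
Proof.
have D1 := is_diff_affine_expR a b (-1) p.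
have D2 := is_diff_affine_expR c d 1 p.
have D3 : is_diff p (fun p : R * R => q * p.2 + r) (fun v => q * v.2).
  have D := is_diff_snd p.
  have : is_diff p ((q *: snd) + cst r) ((q *: snd) + 0) by exact: is_diffD.
  by rewrite addr0.
have D := is_diff_row3 _ _ _ _ _ _ _ _ D1 D2 D3.
have -> : exp_surface a b c d q r = fun p => row3
    ((a * p.1 + b) * expR (-1 * p.2)) ((c * p.1 + d) * expR (1 * p.2))
    (q * p.2 + r).
  by apply/funext => x; rewrite mulN1r mul1r.
apply: is_diff_eq; apply/funext => v /=.
by rewrite !mulN1r !mul1r mulNr.
Qed.

Lemma derive_exp_surface (a b c d q r : R) (v p : R * R) :
  'D_v (exp_surface a b c d q r) p =
  exp_surface (- v.2 * a) (a * v.1 - v.2 * b) (v.2 * c) (c * v.1 + v.2 * d)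
    0 (q * v.2) p.
Proof.
have D := is_diff_exp_surface a b c d q r p.
rewrite deriveE ?diff_val /exp_surface; last by case: D.
by apply: row3_eqP; rewrite !row3E; ring.
Qed.

Lemma derive_exp_surface_fun (a b c d q r : R) (v : R * R) :
  'D_v (exp_surface a b c d q r) =
  exp_surface (- v.2 * a) (a * v.1 - v.2 * b) (v.2 * c) (c * v.1 + v.2 * d)
    0 (q * v.2).
Proof. by apply/funext => p; exact: derive_exp_surface. Qed.

Lemma smooth_exp_surface (a b c d q r : R) : smooth (exp_surface a b c d q r).
Proof.
pose P (f : R * R -> 'rV[R]_3) :=
  exists a b c d q r, f = exp_surface a b c d q r.
apply: (@smooth_of_closed_family R (R^o * R^o)%type _ P).
- move=> f p [a' [b' [c' [d' [q' [r' ->]]]]]].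
  by case: (is_diff_exp_surface a' b' c' d' q' r' p).
- move=> f v [a' [b' [c' [d' [q' [r' ->]]]]]]; rewrite derive_exp_surface_fun.
  by do 6 eexists.
- by exists a, b, c, d, q, r.
Qed.

(** The third coordinate [q * v.2] of the differential determines [v.2]; the first, where [v.1]
    enters through [a * v.1], then determines [v.1]. *)
Lemma immersion_exp_surface (a b c d q r : R) :
  a != 0 -> q != 0 -> immersion (exp_surface a b c d q r).
Proof.
move=> a0 q0; split=> [|p]; first exact: smooth_exp_surface.
have D := is_diff_exp_surface a b c d q r p; split; first by case: D.
rewrite diff_val => -[v1 v2] [w1 w2] /= e.
have /= := congr1 (fun m : 'rV[R]_3 => m 0 2) e.
rewrite !row3E => /(mulfI q0) e2; rewrite e2 in e *.
have /= := congr1 (fun m : 'rV[R]_3 => m 0 0) e.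
rewrite !row3E => /(mulIf (lt0r_neq0 (expR_gt0 _))) /addIr /(mulfI a0) e1.
by rewrite e1.
Qed.

End Surface.

(** * Surfaces generated by lines of slope [eps]; [k] will be the cosine of the angle *)

Section DiagonalLine.
Context {R : realType}.
Variables (k eps x0 : R).
Hypotheses (eps2 : eps ^+ 2 = 1) (k0 : k != 0).

Let line (s : R) : 'rV[R]_3 := s *: row3 k (eps * k) 0 + row3 x0 (eps * x0) 0.

Lemma lineE s : line s = row3 (k * s + x0) (eps * (k * s + x0)) 0.
Proof. by rewrite /line row3Z row3D; congr (row3 _ _ _); ring. Qed.

Lemma line_surfaceE :
  generated_surface line = exp_surface k x0 (eps * k) (eps * x0) 1 0.
Proof.
apply/funext => p; rewrite /generated_surface lineE /sol_L !row3E /exp_surface.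
by congr (row3 _ _ _); ring.
Qed.

Lemma line_direction_neq0 : row3 k (eps * k) 0 != 0.
Proof.
apply/eqP => /(congr1 (fun m : 'rV[R]_3 => m 0 0)); rewrite row3E mxE => /eqP.
exact/negP.
Qed.

Lemma line_minimal : minimal_surface sol_metric (generated_surface line).
Proof.
rewrite line_surfaceE; split.
  by apply: immersion_exp_surface => //; exact: oner_neq0.
move=> [s t]; set psi := exp_surface _ _ _ _ _ _.
have eNK := expRxMexpNx_1 t.
have psi2 : psi (s, t) 0 2 = t by rewrite row3E /=; ring.
(* With [c = k * s + x0], the covariant derivative of [psi_t] along [t] is
   [(- c e^-t, - eps c e^t, 0)], while [psi_s = (k e^-t, eps k e^t, 0)]; the ratio is [- c / k]. *)
apply: (@mean_curvature_sol_eq0 _ _ _ (- ((k * s + x0) / k))).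
(* The [x] and [y] contributions are [- k c] and [eps^2 k c]. *)
- rewrite inner_sol psi2 /psi !derive_exp_surface /exp_surface !row3E /=.
  by rewrite expR_double expRN_double; ring: eNK eps2.
- rewrite derive_exp_surface_fun covD_sol psi2 /psi !derive_exp_surface.
  rewrite /exp_surface !row3E /= row3D.
  rewrite expR_double expRN_double.
  by apply: row3_eqP; rewrite !row3E mxE; ring: eNK eps2.
- rewrite derive_exp_surface_fun covD_sol psi2 /psi !derive_exp_surface.
  rewrite /exp_surface !row3E /= row3D row3Z.
  by rewrite expR_double expRN_double; congr (row3 _ _ _); field: eNK eps2.
Qed.

(** The [L_t] form a one-parameter group, so [L_t] merely shifts the second parameter by [t]. *)
Lemma line_three_invariant :
  three_invariant (range (generated_surface line)).
Proof.
have LD t (p : R * R) :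
    sol_L t (generated_surface line p) = generated_surface line (p.1, p.2 + t).
  rewrite line_surfaceE /sol_L /exp_surface !row3E /=.
  by congr (row3 _ _ _); rewrite ?opprD ?expRD; ring.
move=> t; apply/seteqP; split=> [_ [_ [p _ <-] <-]|_ [p _ <-]].
  by rewrite LD; exists (p.1, p.2 + t).
exists (generated_surface line (p.1, p.2 - t)); first by exists (p.1, p.2 - t).
by rewrite LD /= subrK; case: p.
Qed.

Lemma line_generates_minimal : generates_minimal line.
Proof.
split; [|exact: line_minimal|exact: line_three_invariant].
exact/immersion_affine/line_direction_neq0.
Qed.

Lemma line_ruled : ruled (generated_surface line).
Proof.
move=> t; rewrite line_surfaceE /exp_surface /=.
set u := row3 (k * expR (- t)) (eps * k * expR t) 0.
set w := row3 (x0 * expR (- t)) (eps * x0 * expR t) t.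
have -> : (fun s => row3 ((k * s + x0) * expR (- t))
    ((eps * k * s + eps * x0) * expR t) (1 * t + 0)) = fun s => s *: u + w.
  by apply/funext => s; rewrite row3Z row3D; congr (row3 _ _ _); ring.
split=> [|s]; first exact: smooth_affine.
have eNK := expRxMexpNx_1 t.
have c2 : (s *: u + w) 0 2 = t by rewrite row3Z row3D row3E; ring.
rewrite derive_affine covD_sol derive_affineE derive_cst add0r scale1r c2 /u.
rewrite !row3E expR_double expRN_double.
(* Since [u] has no [z]-component, only [eps^2 k^2 - k^2 = 0] remains to be checked. *)
by apply: row3_eqP; rewrite !row3E mxE; ring: eNK eps2.
Qed.

End DiagonalLine.

(** * Solution curves with constant angle *)

Section ConstantAngle.
Context {R : realType}.

Lemma is_derive_cst_affine (f : R -> R) (c : R) :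
  (forall s, is_derive s (1 : R) f c) -> forall s, f s = c * s + f 0.
Proof.
move=> fD s; pose g := fun t : R => f t - c * t.
have gD t : is_derive t (1 : R) g 0.
  by apply: is_derive_eq; rewrite /GRing.scale /=; ring.
have := is_derive_0_is_cst s 0 gD; rewrite /g mulr0 subr0 => <-; ring.
Qed.

(** The two hypotheses make the right-hand side of the angle equation vanish along the line.
    Uniqueness holds because a fixed angle makes [x'] and [y'] constant, so the starting point
    determines the curve. *)
Lemma constant_angle_solution (th x0 y0 : R) :
  cos th ^+ 2 = sin th ^+ 2 -> x0 * cos th = y0 * sin th ->
  is_the_solution_curve
    (fun s => s *: row3 (cos th) (sin th) 0 + row3 x0 y0 0) (fun=> th)
    (row3 x0 y0 0).
Proof.
move=> cs xy; split.
- exists (fun s => cos th * s + x0), (fun s => sin th * s + y0); split=> s.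
    by rewrite row3Z row3D; congr (row3 _ _ _); ring.
  split.
  + by apply: is_derive_eq; rewrite /GRing.scale /=; ring.
  + by apply: is_derive_eq; rewrite /GRing.scale /=; ring.
  + rewrite [X in X / _](_ : _ = s * (sin th ^+ 2 - cos th ^+ 2)
        + (y0 * sin th - x0 * cos th)); last by ring.
    rewrite cs xy !subrr mulr0 add0r mul0r mulr0.
    exact: is_derive_cst.
- by rewrite scale0r add0r.
- move=> beta [x [y [betaE xyD]]] beta0; apply/funext => s.
  have xE : forall t, x t = cos th * t + x 0.
    by apply: is_derive_cst_affine => t; case: (xyD t).
  have yE : forall t, y t = sin th * t + y 0.
    by apply: is_derive_cst_affine => t; case: (xyD t).
  move: beta0; rewrite betaE => e0.
  have /= := congr1 (fun m : 'rV[R]_3 => m 0 0) e0; rewrite !row3E => x00.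
  have /= := congr1 (fun m : 'rV[R]_3 => m 0 1) e0; rewrite !row3E => y00.
  rewrite betaE xE yE x00 y00 row3Z row3D; congr (row3 _ _ _); ring.
Qed.

(** The double-angle formula at [pi / 2] gives [2 cos^2 - 1 = 0], and nonnegativity selects the
    root. *)
Lemma cos_piquarter : cos (pi / 4 : R) = (Num.sqrt 2)^-1.
Proof.
have c0 : 0 <= cos (pi / 4 : R).
  by apply: cos_ge0_pihalf; have := pi_ge0 R; lra.
rewrite -sqrtrV // -[LHS]ger0_norm // -sqrtr_sqr; congr Num.sqrt.
have := cos_pihalf R; rewrite (_ : pi / 2 = pi / 4 *+ 2); last by field.
by rewrite cos_mulr2n; lra.
Qed.

Lemma sin_piquarter : sin (pi / 4 : R) = cos (pi / 4).
Proof.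
rewrite -cosBpihalf -cosN; congr cos; lra.
Qed.

End ConstantAngle.

(** Treats both types at once: [eps = 1] with angle [pi / 4], and [eps = -1] with angle
    [- pi / 4]. *)
Lemma diagonal_line (R : realType) (eps x0 y0 th : R) :
  eps ^+ 2 = 1 -> y0 = eps * x0 ->
  cos th = (Num.sqrt 2)^-1 -> sin th = eps * cos th ->
  let alpha := fun s : R => (s / Num.sqrt 2) *: row3 1 eps 0 + row3 x0 y0 0 in
  [/\ generates_minimal alpha,
      is_the_solution_curve alpha (fun=> th) (row3 x0 y0 0)
    & ruled (generated_surface alpha)].
Proof.
move=> eps2 -> cth sth alpha.
have c0 : cos th != 0 by rewrite cth invr_eq0 sqrtr_eq0 -ltNge ltr0n.
(* Replacing [1 / sqrt 2] by [cos th] turns [alpha] into the line above with [k = cos th]. *)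
have -> : alpha =
    fun s => s *: row3 (cos th) (eps * cos th) 0 + row3 x0 (eps * x0) 0.
  apply/funext => s; rewrite /alpha -cth !row3Z; congr (row3 _ _ _ + _); ring.
split; [exact: line_generates_minimal| |exact: line_ruled].
rewrite -sth; apply: constant_angle_solution; rewrite sth; ring: eps2.
Qed.

Theorem proposition2p5 (R : realType) (x0 : R) :
  let alpha3 := fun s : R =>
    (s / Num.sqrt 2) *: row3 1 1 0 + row3 x0 x0 0 in
  let alpha4 := fun s : R =>
    (s / Num.sqrt 2) *: row3 1 (-1) 0 + row3 x0 (- x0) 0 in
  [/\ generates_minimal alpha3,
      is_the_solution_curve alpha3 (fun=> pi / 4) (row3 x0 x0 0)
    & ruled (generated_surface alpha3)] /\
  [/\ generates_minimal alpha4,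
      is_the_solution_curve alpha4 (fun=> - (pi / 4)) (row3 x0 (- x0) 0)
    & ruled (generated_surface alpha4)].
Proof.
move=> alpha3 alpha4; split; apply: diagonal_line.
- exact: expr1n.
- by rewrite mul1r.
- exact: cos_piquarter.
- by rewrite mul1r sin_piquarter.
- by rewrite sqrrN expr1n.
- by rewrite mulN1r.
- by rewrite cosN cos_piquarter.
- by rewrite sinN cosN mulN1r sin_piquarter.
Qed.
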